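(* Let $m\ge 1$ and $k\ge 2$ be integers and consider the Conway $(m,k)$-game on $\mathbb{Z}$, with maximum attainable row $n_M$. If $m>1$, then $$n_M \;=\; \left\lfloor \log_{\phi_k}(m) - \log_{\phi_k}(\phi_k-1)\right\rfloor + 1 .$$ If $m=1$, then $n_M=1$, i.e. row $1$ is attainable in finitely many moves but no higher row is.
   Context: The Conway $(m,k)$-game on $\mathbb{Z}$: the board is $\mathbb{Z}$ (cell $j$ is called row $j$), and each cell may hold any nonnegative integer number of checkers. Initially every cell $j\le 0$ holds exactly $m$ checkers and every cell $j>0$ holds none. A move consists of choosing a cell $x$ and a direction $e\in\{+1,-1\}$ such that each of the $k$ cells $x, x+e,\dots,x+(k-1)e$ holds at least one checker; then one checker is removed from each of these $k$ cells and one checker is added to cell $x+ke$. Row $n$ is attainable if some finite sequence of moves from the initial configuration produces a configuration with at least one checker on cell $n$; $n_M$ is the maximum attainable row. The $k$-nacci constant $\phi_k$ is the unique root $x$ with $|x|\ge1$ of $1+x+\cdots+x^{k-1}-x^k$; it is real and lies in $(1,2)$. *)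

(* Defs.v *)
From HB Require Import structures.
From mathcomp Require Import all_boot all_order all_algebra.
From mathcomp Require Import all_classical all_reals all_analysis.
From mathcomp Require Import ring lra.

Set Implicit Arguments.
Unset Strict Implicit.
Unset Printing Implicit Defensive.

Import Order.TTheory GRing.Theory Num.Theory.

Local Open Scope classical_set_scope.
Local Open Scope ring_scope.

Definition config := int -> nat.

Definition initial (m : nat) : config := fun j => if j <= 0 then m else 0%N.

Definition legal (k : nat) (x e : int) (c : config) : Prop :=
  (e = 1 \/ e = -1) /\ forall i : 'I_k, (0 < c (x + e *+ i)%R)%N.

(* For a legal move the [k] cells are distinct and nonempty, so the truncated
   subtraction removes exactly one checker from each of them. *)
Definition play (k : nat) (x e : int) (c : config) : config := fun y =>
  (c y - [exists i : 'I_k, (y == x + e *+ i)%R] + (y == x + e *+ k)%R)%N.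

Inductive reachable (m k : nat) : config -> Prop :=
| reachable_initial : reachable m k (initial m)
| reachable_play c x e :
    reachable m k c -> legal k x e c -> reachable m k (play k x e c).

Definition attainable (m k : nat) (n : int) : Prop :=
  exists2 c, reachable m k c & (0 < c n)%N.

Definition is_max_row (m k : nat) (n : int) : Prop :=
  attainable m k n /\ forall n', attainable m k n' -> n' <= n.

Section Knacci.
Variable R : realType.

Definition knacci_poly (k : nat) : {poly R} := \sum_(i < k) 'X^i - 'X^k.

(* [xget] returns the default value [0] if there is no such root;
   [knacci_root] and [knacci_uniq] show that for [1 < k] there is exactly one. *)
Definition knacci (k : nat) : R :=
  xget 0 [set x | root (knacci_poly k) x /\ 1 <= `|x|].

Definition logb (b x : R) : R := ln x / ln b.

Lemma knacci_polyE k x :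
  (knacci_poly k).[x] = \sum_(i < k) x ^+ i - x ^+ k.
Proof.
rewrite /knacci_poly hornerD hornerN hornerXn horner_sum; congr (_ - _).
by apply: eq_bigr => i _; rewrite hornerXn.
Qed.

Lemma knacci_polyM k x :
  (x - 1) * (knacci_poly k).[x] = x ^+ k * (2 - x) - 1.
Proof. by rewrite knacci_polyE mulrBr -subrX1; ring. Qed.

Lemma knacci_root_gt1 k x :
  (1 < k)%N -> root (knacci_poly k) x -> 1 <= `|x| -> 1 < x.
Proof.
move=> k1 /rootP rx x1.
have [x0|x0] := leP 0 x; last first.
  have := knacci_polyM k x; rewrite rx mulr0 => /esym/eqP.
  rewrite subr_eq0 => /eqP/(congr1 Num.norm); rewrite normrM normrX normr1 => h.
  have h1 : 1 <= `|x| ^+ k by rewrite exprn_ege1.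
  have h2 : 2 <= `|2 - x| by rewrite ger0_norm; lra.
  nra.
rewrite lt_def -{2}(ger0_norm x0) x1 andbT; apply/negP => /eqP xE.
move: rx; rewrite knacci_polyE xE expr1n.
under eq_bigr do rewrite expr1n.
rewrite sumr_const card_ord => /eqP; rewrite subr_eq0 => /eqP h.
by move: k1; rewrite -(ltr_nat R) h ltxx.
Qed.

Lemma knacci_root k : (1 < k)%N ->
  root (knacci_poly k) (knacci k) /\ 1 < knacci k < 2.
Proof.
move=> k1.
have [||x /andP[x1 x2] rx] := @poly_ivt R (- knacci_poly k) 1 2; first by lra.
  rewrite !hornerN !knacci_polyE expr1n; under eq_bigr do rewrite expr1n.
  rewrite sumr_const card_ord; have := subrX1 (2 : R) k.
  have : (1 : R) < k%:R by rewrite ltr1n.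
  by move=> ? ?; apply/andP; split; lra.
rewrite rootN in rx.
have [rk nk] : root (knacci_poly k) (knacci k) /\ 1 <= `|knacci k|.
  apply: (@xgetPex _ _ [set x | root (knacci_poly k) x /\ 1 <= `|x|]).
  by exists x; split => //; rewrite ger0_norm ?(le_trans ler01 x1).
have k_gt1 := knacci_root_gt1 k1 rk nk.
split=> //; rewrite k_gt1 /=.
have := knacci_polyM k (knacci k); rewrite (rootP rk) mulr0 => h.
have : 0 < knacci k ^+ k by rewrite exprn_gt0 //; lra.
by rewrite ltNge => p; apply/negP => q; nra.
Qed.

Lemma knacci_uniq k x : (1 < k)%N ->
  root (knacci_poly k) x -> 1 <= `|x| -> x = knacci k.
Proof.
have aux a b : (1 < k)%N -> 1 < a -> root (knacci_poly k) a ->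
    root (knacci_poly k) b -> a < b -> False.
  move=> k1 a1 /rootP + /rootP + ab; rewrite !knacci_polyE.
  move=> /eqP; rewrite subr_eq0 => /eqP ha /eqP; rewrite subr_eq0 => /eqP hb.
  suff : a ^+ k * \sum_(i < k) b ^+ i < b ^+ k * \sum_(i < k) a ^+ i.
    by rewrite ha hb mulrC ltxx.
  rewrite !mulr_sumr; apply: ltr_sum => [|i _].
    by apply/hasP; exists (Ordinal k1); rewrite ?mem_index_enum.
  have kE z : z ^+ k = z ^+ (k - i) * z ^+ i :> R.
    by rewrite -exprD subnK // ltnW.
  rewrite !kE.
  have p : 0 < a ^+ i * b ^+ i by rewrite mulr_gt0 ?exprn_gt0 //; lra.
  have : a ^+ (k - i) < b ^+ (k - i).
    by rewrite ltrXn2r ?subn_eq0 -?ltnNge //; lra.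
  by move=> ?; nra.
move=> k1 rx x1; have [rk /andP[k_gt1 _]] := knacci_root k1.
have x_gt1 := knacci_root_gt1 k1 rx x1.
by case: (ltgtP x (knacci k)) => // /aux [].
Qed.

End Knacci.

(* Main.v *)
(* Give a checker on row z the weight a^z, where a = knacci k. A rightward move
   preserves the total weight and a leftward one lowers it; the initial weight
   is m a / (a - 1), and it cannot be used up, so a^(n-1) (a - 1) < m for every
   attainable row n.

   Conversely, let a^N (a - 1) <= m and run the game backwards from one checker
   on row N + 1: going down from the top, split the checkers of a row in excess
   of the initial ones into one checker on each of the next k rows. If x(t+k)
   is the number of splits on row N - t, then
   x(t+k) = x(t) + ... + x(t+k-1) - initial(N-t), truncated at 0. It suffices
   that x vanishes eventually. Otherwise no truncation occurs from t = N on, and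
   conservation of weight bounds x. Differences of the recurrence give
   x(t+k+1) + x(t) = 2 x(t+k), whose bounded solutions in natural numbers are
   constant; going back to the initial values, this forces m = 1. *)
Require Import Defs.
From mathcomp Require Import all_boot all_order all_algebra.
From mathcomp Require Import all_classical all_reals all_analysis.
From mathcomp Require Import ring lra zify.

Import Order.TTheory GRing.Theory Num.Theory.

Local Open Scope ring_scope.

(** * Integer sequences given by recurrences over a window of [k] terms *)

(** Induction on the bound. If it is attained at an index at least [k], twice the maximum is a sum
    of two terms, so both are maximal and the value persists; otherwise the shift by [k] obeys a
    smaller bound. *)
Lemma bounded_rec_const k B (y : nat -> nat) : (0 < k)%N ->
  (forall t, y t <= B)%N ->
  (forall t, y (t + k).+1 + y t = 2 * y (t + k))%N ->
  forall t, y t = y 0%N.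
Proof.
move=> k0.
(* Each term is determined by two later ones, so a constant tail extends down to index 0. *)
have back (z : nat -> nat) T M :
    (forall t, z (t + k).+1 + z t = 2 * z (t + k))%N ->
    (forall t, T <= t -> z t = M)%N -> forall t, z t = M.
  move=> zr; elim: T => [|T IH] zM t; first exact: zM.
  apply: IH => {}t; rewrite leq_eqVlt => /predU1P[<-|]; last exact: zM.
  by have := zr T; rewrite (zM (T + k)%N) ?(zM (T + k).+1); lia.
elim: B y => [|B IH] y yB yr t.
  by have := yB t; have := yB 0%N; lia.
have [[s ys]|/forallNP ny] := pselect (exists s, y (s + k)%N = B.+1).
  suff yM : forall t, y t = B.+1 by rewrite !yM.
  apply: (back y (s + k)%N) => // {}t /subnK <-.
  elim: (t - _)%N => // d.
  rewrite addSn addnA; have := yr (d + s)%N; have := yB (d + s)%N.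
  by have := yB (d + s + k).+1; lia.
suff yM : forall t, y t = y k by rewrite !yM.
apply: (back y k) => // {}t /subnK <-.
have := IH (fun u => y (u + k)%N); rewrite add0n; apply.
- by move=> u; have := yB (u + k)%N; have := ny u; lia.
- by move=> u; have := yr (u + k)%N.
Qed.

Lemma window_seq_exists k (cap : nat -> nat) : (0 < k)%N ->
  exists2 x : nat -> nat, (forall i, (i < k)%N -> x i = (i == k.-1)) &
    forall t, x (t + k)%N = (\sum_(t <= j < t + k) x j - cap t)%N.
Proof.
move=> k0.
(* [h t] lists the first [t + k] terms, so [drop t] leaves exactly the window to be summed. *)
pose step t s := rcons s (sumn (drop t s) - cap t)%N.
pose h := fix h t :=
  if t is u.+1 then step u (h u) else rcons (nseq k.-1 0%N) 1%N.
have size_h t : size (h t) = (t + k)%N.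
  elim: t => [|t IH] /=; rewrite size_rcons ?size_nseq; first by rewrite prednK.
  by rewrite IH.
have nthS t i : (i < t + k)%N -> nth 0%N (h t.+1) i = nth 0%N (h t) i.
  by move=> it; rewrite /= nth_rcons size_h it.
have nthD t d i : (i < t + k)%N -> nth 0%N (h (d + t)%N) i = nth 0%N (h t) i.
  by move=> it; elim: d => // d IH; rewrite addSn nthS ?IH //; lia.
pose x i := nth 0%N (h i) i.
have hx t i : (i < t + k)%N -> nth 0%N (h t) i = x i.
  move=> it; rewrite /x; case: (leqP t i) => ti.
    by rewrite -(subnK ti) nthD // subnK.
  by rewrite -(subnK (ltnW ti)) nthD //; lia.
exists x => [i ik|t].
  rewrite -(hx 0%N) //= nth_rcons size_nseq nth_nseq.
  by case: (ltngtP i k.-1) => //; lia.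
rewrite -(hx t.+1) 1?addSn //= nth_rcons size_h ltnn eqxx; congr (_ - _)%N.
rewrite sumnE (big_nth 0%N) size_drop size_h addKn.
have -> : (\sum_(t <= j < t + k) x j = \sum_(0 <= i < k) x (i + t))%N.
  by rewrite -{1}[t]add0n big_addn addKn.
rewrite big_nat [RHS]big_nat.
by apply: eq_bigr => i ik; rewrite nth_drop hx addnC //; lia.
Qed.

(** * Undoing splits by rightward moves *)

Lemma reachable_moves m k c (z : int) s : reachable m k c ->
  (forall i, (i < k)%N -> (s <= c (z + i%:Z)%R)%N) ->
  exists2 c', reachable m k c' &
    forall y, (c' y + s * (z <= y < z + k%:Z)%R = c y + s * (y == z + k%:Z)%R)%N.
Proof.
elim: s => [|s IH] rc cz; first by exists c => // y; rewrite !mul0n.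
have {IH}[|c1 rc1 c1E] := IH rc; first by move=> i /cz; lia.
have c1z i : (i < k)%N -> (0 < c1 (z + i%:Z)%R)%N.
  move=> ik; have := cz _ ik; have := c1E (z + i%:Z).
  have -> : (z <= z + i%:Z < z + k%:Z)%R by lia.
  have -> : (z + i%:Z == z + k%:Z) = false by lia.
  by lia.
exists (play k z 1 c1).
  by apply: reachable_play => //; split; [left|move=> i; rewrite natz c1z].
move=> y; rewrite /play natz.
have -> : [exists i : 'I_k, y == z + 1 *+ i] = (z <= y < z + k%:Z)%R.
  apply/existsP/idP => [[i /eqP ->]|zy].
    by rewrite natz; have := ltn_ord i; lia.
  have yk : (`|y - z| < k)%N by lia.
  by exists (Ordinal yk); rewrite natz /=; apply/eqP; lia.
have := c1E y; case: (boolP (z <= y < z + k%:Z)%R) => zy /=; last by lia.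
have -> : (y == z + k%:Z) = false by lia.
have yk : (`|y - z| < k)%N by lia.
have := c1z _ yk; have -> : z + `|y - z|%N%:Z = y by lia.
by lia.
Qed.

(** Splits are undone from the lowest row up: [x t] rightward moves starting at row [N - t] rebuild
    the checkers split on row [N + k - t]. Index [k.-1] is the wanted checker on row [N + 1]. *)
Lemma attainable_of_splitting m k N T (x : nat -> nat) : (0 < k)%N ->
  x k.-1 = 1%N ->
  (forall t, \sum_(t <= j < t + k) x j <=
     x (t + k) + initial m (N%:Z - t%:Z)%R)%N ->
  (forall j, (T <= j)%N -> x j = 0%N) ->
  attainable m k (N.+1%:Z).
Proof.
move=> k0 x1 xr xT.
(* [x (u + k)] counts the splits on row [N - u]. Only the splits of index below
   [T + k - d] are still to be undone: each row keeps what they require, and the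
   rows they act on still hold their initial checkers. *)
have inv d : (d <= T)%N -> exists2 c, reachable m k c &
    forall u, (((T + k - d <= u + k) -> \sum_(u <= j < T + k - d) x j <=
                   c (N%:Z - u%:Z)%R) /\
               ((u + k < T + k - d) -> initial m (N%:Z - u%:Z)%R <=
                   c (N%:Z - u%:Z)%R))%N.
  elim: d => [|d IH] dT.
    exists (initial m); first exact: reachable_initial.
    move=> u; split=> // uT; rewrite big_nat big1 // => j /andP[uj _].
    by apply: xT; lia.
  have [|c rc cP] := IH; first by lia.
  pose t := (T + k - d.+1)%N.
  have tE : (T + k - d)%N = t.+1 by rewrite /t; lia.
  rewrite tE in cP; rewrite -/t.
  have kt : (k <= t)%N by rewrite /t; lia.
  have [|c' rc' c'E] := @reachable_moves m k c (N%:Z - t%:Z) (x t) rc.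
    move=> i ik; have [+ _] := cP (t - i)%N.
    have -> : N%:Z - (t - i)%N%:Z = N%:Z - t%:Z + i%:Z by lia.
    rewrite big_nat_recr /=; last by lia.
    by move=> h; apply: leq_trans (h _); lia.
  exists c' => // u; have := c'E (N%:Z - u%:Z); have [] := cP u.
  (* Row [N - u] lies below the landing row, above it, or is the landing row; [xr] serves the last
     case. *)
  case: (ltngtP t (u + k)%N) => tu h1 h2 c'u; split=> // _.
  - have := h1 isT; case: (leqP u t) => ut.
      rewrite big_nat_recr //=.
      by move: c'u; case: (_ <= _ < _)%R; case: eqP; lia.
    by move=> _; rewrite big_geq // ltnW.
  - have {}h2 := h2 (leqW tu); move: c'u.
    by case: (boolP (_ <= _ < _)%R); case: eqP; lia.
  - have {h1}h2 : (initial m (N%:Z - u%:Z)%R <= c (N%:Z - u%:Z)%R)%N.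
      by apply: h2; lia.
    have := xr u; rewrite -tu; move: c'u.
    by case: (boolP (_ <= _ < _)%R); case: eqP; lia.
have [c rc cP] := inv T (leqnn T).
have [|c' rc' c'E] := @reachable_moves m k c (N%:Z - k.-1%:Z) 1 rc.
  move=> i ik; have [+ _] := cP (k.-1 - i)%N; rewrite addKn => h.
  have -> : N%:Z - k.-1%:Z + i%:Z = N%:Z - (k.-1 - i)%N%:Z by lia.
  apply: leq_trans (h _); last by lia.
  by rewrite -[X in index_iota _ X](prednK k0) big_nat_recr /= ?x1 ?addn1 //; lia.
exists c' => //; have := c'E N.+1%:Z.
have -> : (N.+1%:Z == N%:Z - k.-1%:Z + k%:Z) by lia.
by case: (boolP (_ <= _ < _)%R); lia.
Qed.

(** * Identities for the k-nacci constant and the weight of a window *)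

Lemma knacci_gt1 (R : realType) k : (1 < k)%N -> 1 < knacci R k.
Proof. by move=> /(knacci_root R) [_ /andP[]]. Qed.

Lemma knacci_expk (R : realType) k : (1 < k)%N ->
  knacci R k ^+ k * (2 - knacci R k) = 1.
Proof.
move=> /(knacci_root R) [/rootP rk _]; apply/eqP.
by rewrite -subr_eq0 -knacci_polyM rk mulr0.
Qed.

Lemma knacci_sum (R : realType) k : (1 < k)%N ->
  \sum_(i < k) knacci R k ^+ i = knacci R k ^+ k.
Proof.
move=> /(knacci_root R) [/rootP + _]; rewrite knacci_polyE => /eqP.
by rewrite subr_eq0 => /eqP.
Qed.

(** The root equation divided by [a ^ k.-1], where [a = knacci R k]: the [k] checkers left by a
    split weigh together [a] times the highest of them. *)
Lemma knacci_sumV (R : realType) k : (1 < k)%N ->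
  \sum_(i < k) (knacci R k)^-1 ^+ i = knacci R k.
Proof.
move=> k1; have := knacci_gt1 R _ k1; have := knacci_expk R _ k1.
have := subrX1 (knacci R k)^-1 k.
set a := knacci R k; set S := \sum_(_ < _) _ => SE aE a1.
have a0 : a != 0 by rewrite gt_eqF //; lra.
have aV : a^-1 ^+ k = 2 - a.
  by rewrite exprVn; apply: (mulfI (expf_neq0 k a0)); rewrite aE divff ?expf_neq0.
have : (1 - a) * (S - a) = 0.
  have : a * (a^-1 ^+ k - 1) = (1 - a) * S by rewrite SE mulrA mulrBr mulfV // mulr1.
  by rewrite aV => h; rewrite mulrBr -h; ring.
by move=> /eqP; rewrite mulf_eq0 !subr_eq0 => /orP[/eqP h|/eqP//]; lra.
Qed.

(* The [i]-th row below the window [x t], ..., [x (t + k - 1)] receives the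
   splits [x (t + i)], ..., [x (t + k - 1)] and has weight [a^-i]; the inner sum
   collects the contributions of one split [x (t + j)] to these rows. *)
Definition window_weight {R : realType} (a : R) k (x : nat -> nat) t : R :=
  \sum_(j < k) (x (t + j)%N)%:R * \sum_(i < j.+1) a^-1 ^+ i.

Lemma le_window_weight (R : realType) (a : R) k x t : 0 < a -> (0 < k)%N ->
  (x t)%:R <= window_weight a k x t.
Proof.
move=> a0; case: k => // k _; rewrite /window_weight big_ord_recl /= addn0.
rewrite big_ord1 expr0 mulr1 lerDl sumr_ge0 // => j _.
rewrite mulr_ge0 // sumr_ge0 // => i _.
by rewrite exprn_ge0 // invr_ge0 ltW.
Qed.

(** Splitting preserves weight, and the [c] checkers supplied by the initial configuration leave the
    account. The outer factor renormalises the next row down to weight 1. *)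
Lemma window_weightS (R : realType) k (x : nat -> nat) t c : (1 < k)%N ->
  (x (t + k) + c = \sum_(t <= j < t + k) x j)%N ->
  window_weight (knacci R k) k x t.+1 =
    knacci R k * (window_weight (knacci R k) k x t - c%:R).
Proof.
move=> k1; have := knacci_gt1 R _ k1; have := knacci_sumV R _ k1.
move: (knacci R k) => a; case: k k1 => // k _ aV a1 xE.
have a0 : a != 0 by rewrite gt_eqF //; lra.
pose g j := \sum_(i < j.+1) a^-1 ^+ i.
have gS j : g j.+1 = 1 + g j / a.
  rewrite /g big_ord_recl expr0 mulr_suml; congr (_ + _).
  by apply: eq_bigr => i _; rewrite -exprSr.
have {xE} : (x (t + k.+1)%N)%:R + c%:R =
    (x t)%:R + \sum_(j < k) (x (t.+1 + j)%N)%:R :> R.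
  rewrite -natrD xE big_ltn; last by lia.
  rewrite natrD; congr (_ + _); rewrite natr_sum addnS.
  rewrite -{1}[t.+1]add0n big_addn subSS addKn big_mkord.
  by apply: eq_bigr => i _; rewrite addnC.
move=> h.
rewrite /window_weight big_ord_recr [in RHS]big_ord_recl /= aV.
rewrite big_ord1 expr0 mulr1 addn0.
have -> : \sum_(i < k) (x (t + bump 0 i)%N)%:R *
    (\sum_(i0 < (bump 0 i).+1) a^-1 ^+ i0) =
    \sum_(j < k) (x (t.+1 + j)%N)%:R +
    (\sum_(j < k) (x (t.+1 + j)%N)%:R * g j) / a.
  rewrite mulr_suml -big_split; apply: eq_bigr => j _ /=.
  by rewrite /bump leq0n add1n -/(g j.+1) gS addSnnS mulrDr mulr1 mulrA.
rewrite -/(g _) addSnnS; move: (\sum_(j < k) _ * _) (\sum_(j < k) _) h => P Q h.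
have -> : (x t)%:R + (Q + P / a) - c%:R = (x (t + k.+1)%N)%:R + P / a by lra.
by field.
Qed.

(** * Termination of the splitting, and the rows it makes attainable *)

Lemma initialE m N t :
  initial m (N%:Z - t%:Z) = if (N <= t)%N then m else 0%N.
Proof. by rewrite /initial subr_le0 lez_nat. Qed.

Lemma splitting_stops (R : realType) m k N (x : nat -> nat) :
  (1 < m)%N -> (1 < k)%N ->
  knacci R k ^+ N * (knacci R k - 1) <= m%:R ->
  (forall i, (i < k)%N -> x i = (i == k.-1)) ->
  (forall t, x (t + k)%N =
     (\sum_(t <= j < t + k) x j - initial m (N%:Z - t%:Z)%R)%N) ->
  exists2 t, (N <= t)%N & x (t + k)%N = 0%N.
Proof.
move=> m1 k1 aN x0 xr; apply: contrapT => nstop.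
have k0 : (0 < k)%N by lia.
have pos t : (N <= t)%N -> (0 < x (t + k))%N.
  by move=> Nt; rewrite lt0n; apply/eqP => xt; apply: nstop; exists t.
have xlo t : (t < N)%N -> (x (t + k) + 0 = \sum_(t <= j < t + k) x j)%N.
  by move=> tN; rewrite xr initialE leqNgt tN subn0 addn0.
have xhi t : (N <= t)%N -> (x (t + k) + m = \sum_(t <= j < t + k) x j)%N.
  by move=> Nt; have := pos t Nt; rewrite xr initialE Nt; lia.
have := knacci_gt1 R _ k1; set a := knacci R k in aN * => a1.
pose W := window_weight a k x.
have Wlo t : (t <= N)%N -> W t = a ^+ t.+1.
  elim: t => [_|t IH tN]; last first.
    rewrite /W (@window_weightS _ _ _ _ 0%N) -/a ?xlo // -/(W t).
    by rewrite IH ?subr0 -?exprS // ltnW.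
  rewrite /W /window_weight -[k](prednK k0) big_ord_recr /= prednK // add0n.
  rewrite x0 ?prednK // eqxx mul1r /a knacci_sumV // big1 ?add0r ?expr1 // => j _.
  by rewrite add0n x0 ?ltn_eqF ?mul0r //; have := ltn_ord j; lia.
(* [m * a / (a - 1)] is the fixed point of [w |-> a * (w - m)], and [aN] says that [W N] does not
   exceed it. *)
have Whi t : (N <= t)%N -> (a - 1) * W t <= m%:R * a.
  move=> /subnK <-; elim: (t - N)%N => [|d IH].
    by rewrite add0n Wlo // exprSr mulrA [_ * a ^+ N]mulrC ler_wpM2r //; lra.
  rewrite addSn /W (@window_weightS _ _ _ _ m) -/a ?xhi ?leq_addl // -/(W _).
  have : a * ((a - 1) * W (d + N)%N) <= a * (m%:R * a) by rewrite ler_wpM2l //; lra.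
  by move: (W _) => w h; lra.
pose y t := x (N + t)%N.
have [B yB] : exists B, forall t, (y t <= B)%N.
  exists (Num.truncn (m%:R * a / (a - 1))) => t.
  rewrite truncn_ge_nat; last by rewrite divr_ge0 ?mulr_ge0 //; lra.
  rewrite ler_pdivlMr ?subr_gt0 // mulrC; apply: le_trans _ (Whi _ (leq_addr t N)).
  by apply: ler_wpM2l; [lra|apply: (le_window_weight R a k x) => //; lra].
have yE t : (y (t + k) + m = \sum_(t <= j < t + k) y j)%N.
  rewrite /y addnA xhi ?leq_addr // (addnC N t) big_addn.
  by rewrite addnAC addnK; apply: eq_bigr => i _; rewrite addnC.
have {yB} yc : forall t, y t = y 0%N.
  apply: (bounded_rec_const k B) => // t.
  have := yE t.+1; rewrite addSn big_nat_recr /=; last by lia.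
  by have := yE t; rewrite big_ltn; lia.
have mc : (y 0 + m = k * y 0)%N.
  rewrite -{1}(yc (0 + k)%N) yE (eq_bigr (fun=> y 0%N)) => [|i _]; last exact: yc.
  by rewrite sum_nat_const_nat add0n subn0.
have xc i : (N <= i)%N -> x i = x N.
  move=> Ni; rewrite -[RHS](congr1 x (addn0 N)).
  by rewrite -/(y 0%N) -(yc (i - N)%N) /y subnKC.
rewrite /y addn0 in mc.
(* For [N = 0] the constant tail would contain both a 0 and the 1 among the first [k] terms. *)
case: N xlo {aN xr nstop Wlo Whi W xhi pos y yE yc} mc xc => [|N] xlo mc xc.
  by have := xc k.-1 isT; rewrite !x0; lia.
have xpos t : (t <= N.+1)%N -> (0 < x (t + k.-1))%N.
  elim: t => [_|t IH tN]; first by rewrite add0n x0 ?eqxx //; lia.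
  rewrite addSnnS prednK //.
  have := xlo t tN; rewrite -[X in index_iota _ (_ + X)%N](prednK k0) addnS.
  by rewrite big_nat_recr /=; have := IH (ltnW tN); lia.
have := xlo N (ltnSn N); rewrite big_ltn; last by lia.
rewrite big_nat (eq_bigr (fun=> x N.+1)) => [|i /andP[Ni _]]; last exact: xc.
rewrite -big_nat sum_nat_const_nat xc; last by lia.
have -> : (N + k - N.+1 = k.-1)%N by lia.
(* With [c = x N.+1], the recurrence reads [c = x N + (k - 1) * c], so [k = 2], [x N = 0] and
   [m = c]. By [xpos] this leaves [N = 0], where [c = x 1 = 1]. *)
move=> cE; have c0 := xpos N.+1 (leqnn _); rewrite xc in c0; last by lia.
have k2 : k = 2 by nia.
case: N {xlo} cE xpos mc xc c0 => [|N] cE xpos mc xc c0.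
  by move: mc; rewrite x0 k2 //=; lia.
by have := xpos N; rewrite k2 addn1; nia.
Qed.

Lemma attainable_rowS (R : realType) m k N : (1 < m)%N -> (1 < k)%N ->
  knacci R k ^+ N * (knacci R k - 1) <= m%:R -> attainable m k N.+1%:Z.
Proof.
move=> m1 k1 aN; have k0 : (0 < k)%N by lia.
have [x x0 xr] := window_seq_exists k (fun t => initial m (N%:Z - t%:Z)) k0.
have [t Nt xt] := splitting_stops R m k N x m1 k1 aN x0 xr.
(* The next window drops [x s] and gains the zero just reached, so its sum stays at most [m]. *)
have xS s : (N <= s)%N -> x (s + k)%N = 0%N -> x (s.+1 + k)%N = 0%N.
  move=> Ns xs; move: (xs); rewrite !xr !initialE Ns leqW //.
  rewrite big_ltn; last by lia.
  by rewrite addSn big_nat_recr /=; lia.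
apply: (attainable_of_splitting m k N (t + k) x) => // [|s|j].
- by rewrite x0 ?prednK // eqxx.
- by rewrite xr; lia.
move=> tj; have -> : j = ((j - (t + k)) + t + k)%N by lia.
elim: (j - (t + k))%N => [|d IH]; first by rewrite add0n.
by rewrite addSn xS //; lia.
Qed.

(** * Upper bound on attainable rows by weights *)

(** The first two terms of [knacci_sumV] give [1 + 1 / a <= a]. This excludes row 2 when [m = 1]. *)
Lemma knacci_sqr_ge (R : realType) k : (1 < k)%N ->
  1 <= knacci R k * (knacci R k - 1).
Proof.
move=> k1; have := knacci_sumV R _ k1; have := knacci_gt1 R _ k1.
move: (knacci R k) => a a1; case: k k1 => [|[|k]] // _.
rewrite 2!big_ord_recl expr0 expr1 => aE.
have a0 : a != 0 by rewrite gt_eqF //; lra.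
have : 1 + a^-1 <= a.
  rewrite -[leRHS]aE addrA lerDl sumr_ge0 // => i _.
  by rewrite exprn_ge0 // invr_ge0; lra.
move=> h; have : a * (1 + a^-1) <= a * a by rewrite ler_wpM2l //; lra.
by rewrite mulrDr mulfV //; lra.
Qed.

Lemma sum_window1 (R : realType) (f : int -> R) K z : (`|z| <= K)%N ->
  \sum_(i < K.*2.+1) (i%:Z - K%:Z == z)%:R * f (i%:Z - K%:Z) = f z.
Proof.
move=> zK; have iK : (`|(z + K%:Z)%R| < K.*2.+1)%N by lia.
have zE : `|(z + K%:Z)%R|%N%:Z - K%:Z = z by lia.
rewrite (bigD1 (Ordinal iK)) //= zE eqxx mul1r big1 ?addr0 // => i.
move=> /eqP ni; case: eqP => [h|_]; last by rewrite mul0r.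
by case: ni; apply/val_inj => /=; lia.
Qed.

Lemma playE k x e c y : legal k x e c ->
  (play k x e c y + \sum_(i < k) (y == x + e *+ i :> int)%R =
   c y + (y == x + e *+ k :> int)%R)%N.
Proof.
move=> [eE cE]; rewrite /play.
have inj i j : (x + e *+ i == x + e *+ j) = (i == j).
  rewrite (inj_eq (addrI x)).
  by case: eE => ->; rewrite ?mulNrn ?eqr_opp !natz eqz_nat.
have [i /eqP yi|ny] := pickP (fun i : 'I_k => y == x + e *+ i).
  have -> : [exists i : 'I_k, y == x + e *+ i] by apply/existsP; exists i; apply/eqP.
  rewrite (bigD1 i) //= yi eqxx big1 => [|j /negPf ji].
    by have := cE i; lia.
  by rewrite inj eq_sym [_ == _]ji.
rewrite big1 => [|i _]; last by rewrite ny.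
have -> : [exists i : 'I_k, y == x + e *+ i] = false.
  by apply/existsP => -[i]; rewrite ny.
by rewrite subn0 addn0.
Qed.

(* A window of rows keeps the weight of an infinite configuration a finite sum. *)
Definition row_weight {R : realType} (a : R) K (c : config) : R :=
  \sum_(i < K.*2.+1) (c (i%:Z - K%:Z))%:R * a ^ (i%:Z - K%:Z).

Lemma le_row_weight_play (R : realType) k K x e c : (1 < k)%N ->
  legal k x e c -> (`|x| + k <= K)%N ->
  row_weight (knacci R k) K (play k x e c) <= row_weight (knacci R k) K c.
Proof.
move=> k1 lc xK; have := knacci_gt1 R _ k1; have := knacci_sum R _ k1.
rewrite /row_weight; set a := knacci R k => aE a1.
have a0 : a != 0 by rewrite gt_eqF //; lra.
have xeK i : (i <= k)%N -> (`|(x + e *+ i)%R| <= K)%N.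
  by move=> ik; case: lc.1 => ->; rewrite ?mulNrn natz; lia.
have le_land : a ^ (x + e *+ k) <= \sum_(i < k) a ^ (x + e *+ i).
  case: lc.1 => ->.
    under eq_bigr do rewrite expfzDr // natz.
    by rewrite -mulr_sumr aE expfzDr // natz.
  (* For a leftward move, the checker removed from [x] alone outweighs the one that lands. *)
  case: k k1 {lc xK aE xeK} @a a1 a0 => // k _ a a1 a0.
  rewrite big_ord_recl mulr0n addr0 -[leLHS]addr0 lerD //.
    by rewrite ler_eXz2l // mulNrn; lia.
  by rewrite sumr_ge0 // => i _; rewrite exprz_ge0 //; lra.
(* Adding the removed weight to both sides reduces the claim to [playE] summed against the
   weights. *)
rewrite -(lerD2r (\sum_(i < k) a ^ (x + e *+ i))).
apply: le_trans (_ : _ <= \sum_(i < K.*2.+1)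
  (c (i%:Z - K%:Z))%:R * a ^ (i%:Z - K%:Z) + a ^ (x + e *+ k)) _;
  last by rewrite lerD2l.
rewrite -(@sum_window1 _ (fun z => a ^ z) K (x + e *+ k)) ?xeK // -big_split /=.
have -> : \sum_(i < k) a ^ (x + e *+ i) = \sum_(j < K.*2.+1)
    (\sum_(i < k) (j%:Z - K%:Z == x + e *+ i)%R)%N%:R * a ^ (j%:Z - K%:Z).
  under [RHS]eq_bigr do rewrite natr_sum mulr_suml.
  rewrite exchange_big /=; apply: eq_bigr => i _.
  by rewrite (@sum_window1 _ (fun z => a ^ z)) // xeK // ltnW.
rewrite -big_split /= le_eqVlt; apply/orP; left; apply/eqP.
by apply: eq_bigr => i _; rewrite -!mulrDl -!natrD playE.
Qed.

(** Finitely many moves touch finitely many rows; [K0] bounds them all. *)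
Lemma reachable_row_weight (R : realType) m k c : (1 < k)%N ->
  reachable m k c -> exists K0, forall K, (K0 <= K)%N ->
    row_weight (knacci R k) K c <= row_weight (knacci R k) K (initial m).
Proof.
move=> k1; elim=> [|{}c x e _ [K0 IH] lc]; first by exists 0%N.
exists (maxn K0 (`|x| + k)) => K; rewrite geq_max => /andP[K0K xK].
exact: le_trans (le_row_weight_play _ _ _ _ _ _ k1 lc xK) (IH K K0K).
Qed.

(** A finite geometric sum falls short of its limit [a / (a - 1)], whence the strict inequality. *)
Lemma row_weight_initial (R : realType) (a : R) m K : 1 < a -> (0 < m)%N ->
  row_weight a K (initial m) * (a - 1) < m%:R * a.
Proof.
move=> a1 m0; have a0 : a != 0 by rewrite gt_eqF //; lra.
have -> : row_weight a K (initial m) = m%:R * \sum_(i < K.+1) a^-1 ^+ i.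
  rewrite /row_weight -(big_mkord xpredT (fun i =>
    (initial m (i%:Z - K%:Z))%:R * a ^ (i%:Z - K%:Z))).
  rewrite (@big_cat_nat _ _ _ K.+1) //=; last by lia.
  rewrite [X in _ + X]big_nat [X in _ + X]big1 ?addr0; last first.
    by move=> i /andP[Ki _]; rewrite /initial subr_le0 lez_nat leqNgt Ki mul0r.
  rewrite big_mkord mulr_sumr (reindex_inj rev_ord_inj) /=.
  apply: eq_bigr => i _; have := ltn_ord i; rewrite ltnS => iK.
  rewrite subSS /initial subr_le0 lez_nat leq_subr -subzn //.
  by rewrite addrAC subrr add0r -exprz_inv.
have := subrX1 a^-1 K.+1; set S := \sum_(_ < _) _ => SE.
have : S * (a - 1) = a * (1 - a^-1 ^+ K.+1).
  have : a * (a^-1 ^+ K.+1 - 1) = (1 - a) * S.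
    by rewrite SE mulrA mulrBr mulfV // mulr1.
  by move=> h; rewrite mulrC -[1 - _]opprB mulrN h; ring.
rewrite -mulrA => ->; rewrite ltr_pM2l ?ltr0n //.
have : 0 < a^-1 ^+ K.+1 by rewrite exprn_gt0 // invr_gt0; lra.
by move=> p; nra.
Qed.

Lemma attainable_ub (R : realType) m k n : (0 < m)%N -> (1 < k)%N ->
  attainable m k n -> knacci R k ^ (n - 1) * (knacci R k - 1) < m%:R.
Proof.
move=> m0 k1 [c rc cn].
have [K0 /(_ (maxn K0 `|n|))] := reachable_row_weight R m k c k1 rc.
set K := maxn _ _ => /(_ (leq_maxl _ _)).
have := knacci_gt1 R _ k1; set a := knacci R k => a1 cK.
have a0 : a != 0 by rewrite gt_eqF //; lra.
have aV z : 0 <= a ^ z by rewrite exprz_ge0 //; lra.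
have nc : a ^ n <= row_weight a K c.
  rewrite -(@sum_window1 _ (fun z => a ^ z) K n) ?leq_maxr //.
  apply: ler_sum => i _; rewrite ler_wpM2r // ler_nat.
  by case: eqP => // ->.
have wm := row_weight_initial _ _ _ K a1 m0.
rewrite -(ltr_pM2r (lt_trans ltr01 a1)); apply: le_lt_trans wm.
have -> : a ^ (n - 1) * (a - 1) * a = a ^ n * (a - 1).
  by rewrite mulrAC -[X in _ * X * _]expr1z -expfzDr // subrK.
by rewrite ler_wpM2r ?(le_trans nc) //; lra.
Qed.

(** * Passage to logarithms and conclusion *)

Lemma le_logb_knacci (R : realType) m k (p : int) : (0 < m)%N -> (1 < k)%N ->
  (p%:~R <= logb (knacci R k) m%:R - logb (knacci R k) (knacci R k - 1)) =
  (knacci R k ^ p * (knacci R k - 1) <= m%:R).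
Proof.
move=> m0 k1; have := knacci_gt1 R _ k1; move: (knacci R k) => a a1.
have ap : 0 < a by lra.
rewrite /logb -mulrBl ler_pdivlMr ?ln_gt0 // lerBrDr.
rewrite -[RHS]ler_ln ?posrE ?ltr0n ?mulr_gt0 ?exprz_gt0 ?subr_gt0 //.
rewrite lnM ?posrE ?exprz_gt0 ?subr_gt0 //; congr (_ + _ <= _).
by rewrite -powR_intmul ?ln_powR // ltW.
Qed.

Theorem theorem3 (R : realType) (m k : nat) (hm : (1 <= m)%N) (hk : (2 <= k)%N) :
  ((1 < m)%N ->
     is_max_row m k
       (Num.floor (logb (knacci R k) m%:R
                   - logb (knacci R k) (knacci R k - 1)) + 1)) /\
  (m = 1%N -> is_max_row m k 1).
Proof.
have a1 := knacci_gt1 R _ hk; have a2 : knacci R k < 2.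
  by have [_ /andP[]] := knacci_root R hk.
split=> [m1|m1].
  set L := _ - _; split=> [|n /(attainable_ub R m k n hm hk)/ltW].
    (* [attainable_rowS] takes a natural exponent; the floor is nonnegative since
       [a - 1 < 1 <= m]. *)
    have L0 : (0 <= Num.floor L)%R.
      rewrite floor_ge_int le_logb_knacci // expr0z mul1r.
      by apply: le_trans (_ : _ <= 1) _; [lra|rewrite ler1n].
    have := floor_le L; rewrite le_logb_knacci //.
    case: (Num.floor L) L0 => // N _ aN.
    by have := attainable_rowS R m k N m1 hk aN; rewrite -addn1.
  by rewrite -le_logb_knacci // -floor_ge_int lerBlDr.
rewrite {}m1 in hm *; split=> [|n /(attainable_ub R 1 k n hm hk) an].
  have [|c rc cE] := @reachable_moves 1 k _ (1 - k%:Z) 1 (reachable_initial 1 k).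
    by move=> i ik; rewrite /initial ifT //; lia.
  exists c => //; have := cE 1; rewrite subrK eqxx.
  by case: (boolP (_ <= _ < _)%R); lia.
(* For [n >= 2] the weight bound would give [a * (a - 1) < 1]. Strictness matters: equality holds at
   [k = 2]. *)
rewrite leNgt; apply/negP => n1; move: an; rewrite ltNge => /negP; apply.
apply: le_trans (knacci_sqr_ge R _ hk) _; rewrite ler_wpM2r //; first by lra.
by rewrite -[leLHS]expr1z ler_weXz2l //; lia || lra.
Qed.
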